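(* Let $B$ be a compact topological space and let $0\in B$ be a point such that the subspace $B\setminus\{0\}$ is Lindelöf. Then for every cardinal $\kappa$, the space \[ X=B^{\kappa}\setminus\{\vec{0}\} \] is star-Lindelöf, where $\vec{0}\in B^{\kappa}$ is the point all of whose coordinates are equal to $0$.
   Context: $B^{\kappa}$ carries the product topology, and $X$ the subspace topology. ''Compact'' means every open cover has a finite subcover and ''Lindelöf'' means every open cover has a countable subcover; no separation axioms are assumed. For a family $\mathcal{U}$ of subsets of a space $X$ and $F\subset X$, put $\mathrm{St}(F,\mathcal{U}):=\bigcup\{U\in\mathcal{U}: U\cap F\neq\emptyset\}$. A topological space $X$ is star-Lindelöf if for every open cover $\mathcal{U}$ of $X$ there exists a countable set $F\subset X$ such that $\mathrm{St}(F,\mathcal{U})=X$. *)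

(* Defs.v *)
From mathcomp Require Import all_boot all_classical topology.

Set Implicit Arguments.
Unset Strict Implicit.
Unset Printing Implicit Defensive.

Local Open Scope classical_set_scope.

Definition open_cover (T : topologicalType) (U : set (set T)) : Prop :=
  (forall A, U A -> open A) /\ \bigcup_(A in U) A = [set: T].

Definition star (T : Type) (F : set T) (U : set (set T)) : set T :=
  \bigcup_(A in [set A | U A /\ A `&` F !=set0]) A.

(* [countable] includes the finite case. *)
Definition lindelof_space (T : topologicalType) : Prop :=
  forall U : set (set T), open_cover U ->
    exists V : set (set T),
      [/\ V `<=` U, countable V & \bigcup_(A in V) A = [set: T]].

Definition star_lindelof_space (T : topologicalType) : Prop :=
  forall U : set (set T), open_cover U ->
    exists F : set T, countable F /\ star F U = [set: T].

(* Main.v *)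
Require Import Defs.
From HB Require Import structures.
From mathcomp Require Import all_boot finmap all_classical wochoice topology.

Local Open Scope classical_set_scope.

(** By the tube lemma each slab [{x | x_a <> 0}] is covered by countably many
boxes contained in members of the cover, whose supports have a countable union
[S_a].  Let [cl a] be the countable closure of [{a}] under [S], well-order [K],
and let [rho b] be the least [a] with [b] in [cl a]; then [rho] does not
increase from [b] to an element of [S_b].  For [x <> 0] let [a] be the least
value of [rho] on the support of [x]: the box containing [x] only constrains
coordinates [k] with [rho k = a], and finitely many [k] with [rho k < a], where
[x] vanishes.  Colour [K] by [nat -> bool] so that the colour of [a] differs
from those of all smaller elements of [rho @` cl a], which is possible because
they are countably many.  The countable set consists of the points [f_(s, n)],
for [s] a finite bit sequence: on the block [rho = a], [f_(s, n)] copies a point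
of the [n]-th box attached to [a] if [s] is a prefix of the colour of [a], and
it is zero otherwise.  A long enough prefix [s] of the colour of [a] makes
[f_(s, n)] vanish on the finitely many constrained lower blocks. *)

(** * Well-orders, colourings and the countable hitting set *)

Lemma countable_sub_range {T : choiceType} (x0 : T) (A : set T) :
  countable A -> exists e : nat -> T, A `<=` range e.
Proof.
move=> /countable_injP[f injf].
exists (fun n => xget x0 [set y | A y /\ f y = n]) => x Ax; exists (f x) => //.
case: xgetP => [y _ [Ay fyx]|/(_ x) /not_andP[]//].
by apply: injf => //; exact: mem_set.
Qed.

(** Cantor's diagonal argument. *)
Lemma exists_notin_countable (A : set (nat -> bool)) :
  countable A -> exists r, ~ A r.
Proof.
move=> /(countable_sub_range (fun=> true))[e Ae].
exists (fun n => ~~ e n n) => /Ae[n _] /(congr1 (@^~ n)).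
by case: (e n n).
Qed.

Lemma exists_well_founded_total (K : Type) :
  exists lt : K -> K -> Prop,
    well_founded lt /\ forall a b, [\/ lt a b, a = b | lt b a].
Proof.
have [R woR] := well_ordering_principle {classic K}.
have wR : wo_chain R predT by exact: withinW.
have anti := wo_chain_antisymmetric wR.
exists (fun a b => ~~ R b a); split.
  move=> a; apply: contrapT => na.
  (* A least inaccessible element would have only accessible predecessors. *)
  have [|m [[/asboolP nm lbm] _]] :=
      woR (fun x => `[< ~ Acc (fun a b => ~~ R b a) x >]).
    by exists a; apply/asboolP.
  apply: nm; constructor => y /negP Rmy; apply: contrapT => ny; apply: Rmy.
  by apply: lbm; apply/asboolP.
move=> a b; have [Rba|] := boolP (R b a); last by constructor 1.
have [Rab|] := boolP (R a b); last by constructor 3.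
by constructor 2; apply: anti => //; rewrite Rab.
Qed.

Lemma well_founded_min {K : Type} {lt : K -> K -> Prop} (A : set K) :
  well_founded lt -> A !=set0 -> exists2 m, A m & forall a, A a -> ~ lt a m.
Proof.
move=> wf [a Aa]; apply: contrapT => nomin.
suff : forall b, ~ A b by move/(_ a).
move=> b; elim/(well_founded_ind wf): b => b IH Ab.
by apply: nomin; exists b => // c Ac /IH.
Qed.

(** Well-founded recursion: the colours already given below [a] to members of [D a] are countably
    many, so the diagonal argument supplies a further one. *)
Lemma exists_coloring {K : Type} (lt : K -> K -> Prop) (D : K -> set K) :
  well_founded lt -> (forall a, countable (D a)) ->
  exists c : K -> nat -> bool, forall a b, D a b -> lt b a -> c b <> c a.
Proof.
move=> wf cD.
pose step a (rec : forall b, lt b a -> nat -> bool) : nat -> bool :=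
  xget (fun=> true) [set r | forall b (ba : lt b a), D a b -> rec b ba <> r].
pose c := Fix wf _ step; exists c => a.
have -> : c a = step a (fun b _ => c b).
  apply: Fix_eq => x f g fg; congr (step x _).
  apply: functional_extensionality_dep => y.
  exact: functional_extensionality_dep.
move=> b Dab ba.
rewrite /step; case: xgetP => [r _ /(_ b ba Dab)//|].
have [r nr] : exists r, ~ (c @` D a) r.
  apply: exists_notin_countable.
  exact: card_le_trans (card_image_le _ _) (cD a).
by move/(_ r) => [] d da Dad cdr; apply: nr; exists d.
Qed.

(** Each [c b] differs from [c a] at some position; [k] exceeds one such position for each of the
    finitely many [b]. *)
Lemma separating_prefix {K : Type} (c : K -> nat -> bool) (a : K) (A : set K) :
  finite_set A -> (forall b, A b -> c b <> c a) ->
  exists k, forall b, A b -> mkseq (c b) k <> mkseq (c a) k.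
Proof.
move=> finA cA.
have /choice[d dP] : forall b, exists n, A b -> c b n <> c a n.
  move=> b; apply: contrapT => /forallNP nd.
  have [Ab|nAb] := pselect (A b); last by apply: (nd 0%N).
  apply: (cA b Ab); apply/funext => n; apply: contrapT => ne.
  by apply: (nd n).
have [m dm] : exists m, forall b, A b -> (d b < m)%N.
  have /finite_seqP[s As] : finite_set (A : set {classic K}) by [].
  exists (\max_(b <- s) d b).+1 => b; rewrite As => /= bs.
  by rewrite ltnS; apply: leq_bigmax_seq.
exists m => b Ab /(congr1 (fun s => nth false s (d b))).
by rewrite !nth_mkseq ?dm//; exact: dP.
Qed.

Lemma closed_coloring {K : Type} (S : K -> set K) :
  (forall a, countable (S a)) ->
  exists (lt : K -> K -> Prop) (cl : K -> set K) (rho : K -> K)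
      (c : K -> nat -> bool),
    [/\ well_founded lt, forall a, countable (cl a), forall a, cl (rho a) a,
      forall a b x, cl x a -> S a b -> cl x b /\
        (rho b = rho a \/ lt (rho b) (rho a)) &
      forall x b, cl x b -> lt (rho b) x -> c (rho b) <> c x].
Proof.
move=> cS.
have [lt [wf tot]] := exists_well_founded_total K.
(* [L a n] collects what is reached from [a] in exactly [n] steps along [S]. *)
pose L a := fix L n := if n is m.+1 then \bigcup_(b in L m) S b else [set a].
pose cl a := \bigcup_n L a n.
have clS x a b : cl x a -> S a b -> cl x b.
  by move=> [n _ xa] ab; exists n.+1 => //; exists a.
have ccl a : countable (cl a).
  apply: bigcup_countable => // n _; elim: n => [|n IH]; first exact: countable1.
  exact: bigcup_countable.
have /choice[rho rhoP] b :
    exists a, cl a b /\ forall d, cl d b -> ~ lt d a.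
  have [|a ba amin] := @well_founded_min K lt [set a | cl a b] wf.
    by exists b; exists 0%N.
  by exists a.
have [c cP] := @exists_coloring K lt (fun x => rho @` cl x) wf
  (fun x => card_le_trans (card_image_le _ _) (ccl x)).
exists lt, cl, rho, c; split => //.
- by move=> a; have [] := rhoP a.
- move=> a b x xa ab; split; first exact: clS ab.
  have [_ /(_ (rho a)) nlt] := rhoP b.
  (* [b] lies in [cl (rho a)] because [a] does, so minimality of [rho b] excludes
     [lt (rho a) (rho b)]. *)
  have /nlt {}nlt : cl (rho a) b by apply: clS ab; have [] := rhoP a.
  by case: (tot (rho b) (rho a)) => //; [right|left].
- by move=> x b xb; apply: cP; exists b.
Qed.

(** The combinatorial core, free of topology: [N i] stands for a box with support [S i], and [Y a]
    indexes boxes that cover the slab at [a]. *)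
Lemma countable_hitting {K I : Type} {B : choiceType} (b0 : B)
    (S : I -> set K) (N : I -> set (K -> B)) (Y : K -> set I) :
  (forall i, finite_set (S i)) ->
  (forall i p q, (forall k, S i k -> p k = q k) -> N i p -> N i q) ->
  (forall a, countable (Y a)) ->
  (forall a x, x a <> b0 -> exists2 i, Y a i & N i x) ->
  exists F : set (K -> B),
    [/\ countable F, forall f, F f -> f <> (fun=> b0) &
      forall x, x <> (fun=> b0) ->
        exists i, N i x /\ N i `&` F !=set0].
Proof.
move=> finS NS cY YN.
have cSY a : countable (\bigcup_(i in Y a) S i).
  by apply: bigcup_countable => // i _; exact: finite_set_countable.
have [lt [cl [rho [c [wf ccl clrho clS cP]]]]] := closed_coloring _ cSY.
pose Z x := \bigcup_(a in cl x) Y a.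
have cZ x : countable (Z x) by exact: bigcup_countable.
have /choice[code codeP] x : exists f : I -> nat, {in Z x &, injective f}.
  exact/countable_injP.
(* The nonzero coordinate in block [x] ensures that a function copying [p] on that block is not the
   zero point. *)
pose Q x i (p : K -> B) := [/\ N i p, forall k, lt (rho k) x -> p k = b0 &
  exists2 k, rho k = x & p k <> b0].
pose p x n : K -> B := xget (fun=> b0)
  [set p | exists i, [/\ Z x i, code x i = n & Q x i p]].
pose f (sn : seq bool * nat) : K -> B := fun k =>
  if mkseq (c (rho k)) (size sn.1) == sn.1 then p (rho k) sn.2 k else b0.
(* [f sn] is zero when [sn.1] is a prefix of no colour, so the zero point is removed. *)
exists (range f `&` [set f | f <> (fun=> b0)]); split.
- apply: (@sub_countable _ (seq bool * nat)%type _ setT); last exact: countableP.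
  apply: card_le_trans (card_image_le f setT).
  by apply: subset_card_le => ? [].
- by move=> ? [].
move=> x x0.
have [k xk] : exists k, x k <> b0.
  apply: contrapT => /forallNP xb0; apply: x0; apply/funext => k.
  exact: contrapT.
have [|r [a xa <- {k xk r}] rmin] :=
    @well_founded_min K lt (rho @` [set k | x k <> b0]) wf.
  by exists (rho k), k.
have [i Yai Nix] := YN a x xa; exists i; split => //.
have Zi : Z (rho a) i by exists a.
pose n := code (rho a) i.
(* [x] itself satisfies [Q], by minimality of [rho a], so [xget] does not return its default;
   injectivity of [code] shows that the index it used is [i]. *)
have [Npi plow [h rhoh ph]] : Q (rho a) i (p (rho a) n).
  rewrite /p; case: xgetP => [q _ [j [Zj ji]]|/(_ x)[]].
    by have -> : j = i by apply: (codeP (rho a)) => //; exact: mem_set.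
  exists i; split => //; split => //; last by exists a.
  by move=> k ka; apply: contrapT => xk; apply: (rmin (rho k)) ka; exists k.
have Scl k : S i k -> cl (rho a) k /\ (rho k = rho a \/ lt (rho k) (rho a)).
  by move=> ik; apply: (clS a) => //; exists i.
have [m mP] : exists m, forall r,
    (rho @` (S i `&` [set k | lt (rho k) (rho a)])) r ->
    mkseq (c r) m <> mkseq (c (rho a)) m.
  apply: separating_prefix.
    by apply: finite_image; exact: sub_finite_set (finS i).
  by move=> _ [k [ik ka] <-]; apply: cP => //; have [] := Scl k ik.
pose s := mkseq (c (rho a)) m.
have fs k : rho k = rho a -> f (s, n) k = p (rho a) n k.
  by move=> ka; rewrite /f /= size_mkseq ka eqxx.
exists (f (s, n)); split.
  (* On [S i] the function [f (s, n)] agrees with [p (rho a) n]: block [rho a] is copied, and on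
     lower blocks both vanish, the prefixes there being different from [s]. *)
  apply: NS Npi => k ik; have [_ [ka|ka]] := Scl k ik; first by rewrite fs.
  rewrite plow// /f /= size_mkseq ifN//; apply/eqP/mP.
  by exists k.
split; first by exists (s, n).
by move/(congr1 (@^~ h)); rewrite fs.
Qed.

(** * Boxes in the product and the tube lemma *)

Definition box {K B : Type} (S : set K) (O : K -> set B) : set (K -> B) :=
  [set y | forall k, S k -> O k (y k)].

(** The product topology is the coarsest with continuous projections, so it suffices that the filter
    [G] generated by boxes around [x] converges to [x] in every coordinate. *)
Lemma nbhs_box {K : Type} {B : topologicalType} (x : {ptws K -> B})
    (W : set {ptws K -> B}) :
  nbhs x W -> exists SO : set K * (K -> set B),
    [/\ finite_set SO.1, forall k, open_nbhs (x k) (SO.2 k) &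
        box SO.1 SO.2 `<=` W].
Proof.
pose G : set_system {ptws K -> B} := [set A | exists SO : set K * (K -> set B),
    [/\ finite_set SO.1, forall k, open_nbhs (x k) (SO.2 k) &
        box SO.1 SO.2 `<=` A]].
have FG : Filter G.
  split.
  - exists (set0, fun=> setT); split => //= k.
    by split => //; exact: openT.
  - move=> P Q [[S O] /= [fS oO sP]] [[S' O'] /= [fS' oO' sQ]].
    exists (S `|` S', fun k => O k `&` O' k); split => /=.
    + by rewrite finite_setU.
    + by move=> k; exact: open_nbhsI.
    + move=> y yb; split; [apply: sP|apply: sQ] => k Sk.
        by have [] := yb k (or_introl Sk).
      by have [] := yb k (or_intror Sk).
  - move=> P Q PQ [SO [fS oO sP]]; exists SO; split => //.
    exact: subset_trans PQ.
suff : G --> x by exact.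
apply/cvg_sup => k A [_ [[V oV <-] /= Vx] VA].
exists ([set k], fun j => if pselect (j = k) is left _ then V else setT).
split => /=; first exact: finite_set1.
  move=> j; case: pselect => [->//|_].
  by split => //; exact: openT.
by move=> y /(_ k erefl); case: pselect => // _; exact: VA.
Qed.

Lemma open_box {K : Type} {B : topologicalType} (S : set K) (O : K -> set B) :
  finite_set S -> (forall k, open (O k)) ->
  open (box S O : set {ptws K -> B}).
Proof.
move=> /(@finite_fsetP {classic K})[X ->] oO.
rewrite (_ : box _ _ = \bigcap_(k in [set` X]) ((fun y => y k) @^-1` O k)) //.
rewrite openE => x xO; apply: filter_bigI => k kX.
apply: (@proj_continuous {classic K} (fun=> B)).
by apply: open_nbhs_nbhs; split => //; exact: xO.
Qed.

(* [compact_cover] is stated for pointed spaces only. *)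
Lemma cover_compactE {T : topologicalType} (t : T) (A : set T) :
  cover_compact A = compact A.
Proof.
pose P : ptopologicalType := HB.pack (Topological.sort T) (isPointed.Build T t).
by rewrite -[RHS]/(@compact P A) compact_cover.
Qed.

(** Tychonoff: the slice is a product with the singleton of [b] at [a] and all of [B] elsewhere. *)
Lemma slice_compact {K : Type} {B : topologicalType} (a : K) (b : B) :
  cover_compact [set: B] ->
  cover_compact [set x : {ptws K -> B} | x a = b].
Proof.
rewrite (cover_compactE b) (@cover_compactE {ptws K -> B} (fun=> b)) => cB.
pose A (k : {classic K}) : set B := [set z | k = a -> z = b].
have -> : [set x : {ptws K -> B} | x a = b] = [set x | forall k, A k (x k)].
  by apply/seteqP; split => x /= => [xa k -> //|]; exact.
apply: (@tychonoff {classic K} (fun=> B)) => k.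
rewrite /A; have [->|ka] := pselect (k = a).
  rewrite (_ : [set z | _] = [set b]); first exact: compact_set1.
  by apply/seteqP; split => z /=; [exact|move=> -> _].
rewrite (_ : [set z | _] = setT) //.
by apply/seteqP; split => z //= _ /ka.
Qed.

(** Finitely many boxes cover the compact slice over [b]; [V] is the interior of the intersection of
    their constraints at [a] that contain [b]. *)
Lemma tube_boxes {K : Type} {B : topologicalType} {I : choiceType}
    (S : I -> set K) (O : I -> K -> set B) (a : K) (b : B) :
  cover_compact [set: B] ->
  (forall i, finite_set (S i)) -> (forall i k, open (O i k)) ->
  [set x : K -> B | x a = b] `<=` \bigcup_i box (S i) (O i) ->
  exists V D, [/\ open_nbhs b V, finite_set D &
    [set x : K -> B | V (x a)] `<=` \bigcup_(i in D) box (S i) (O i)].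
Proof.
move=> cB fS oO cov.
have [D _ covD] := @slice_compact K B a b cB I setT
  (fun i => box (S i) (O i))
  (fun i _ => open_box (S i) (O i) (fS i) (oO i)) cov.
pose W i := [set z | S i a -> O i a b -> O i a z].
exists ((\bigcap_(i in [set` D]) W i)^°), [set` D]; split => //.
  split; first exact: open_interior.
  apply: filter_bigI => i _.
  have [Ob|nOb] := pselect (O i a b); last by apply: nearW => z _ /nOb.
  apply: (@filterS _ _ _ (O i a)); first by move=> z Oz _ _.
  by apply: open_nbhs_nbhs; split.
move=> x /= /interior_subset Wx.
(* [y] is [x] moved onto the slice; a chosen box containing [y] also contains [x], since [x a] lies
   in [V]. *)
pose y k := if pselect (k = a) is left _ then b else x k.
have /covD[i Di yi] : y a = b by rewrite /y; case: pselect.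
exists i => // k Sk; have := yi k Sk; rewrite /y; case: pselect => // ka.
rewrite {k}ka in Sk *; exact: Wx.
Qed.

(** By the tube lemma, the open sets over which finitely many boxes suffice cover [B] minus [b0]; a
    countable subcover then uses countably many boxes. *)
Lemma lindelof_slab {K : Type} {B : topologicalType} {I : choiceType} (b0 : B)
    (S : I -> set K) (O : I -> K -> set B) (a : K) :
  cover_compact [set: B] ->
  lindelof_space (set_type (~` [set b0])) ->
  (forall i, finite_set (S i)) -> (forall i k, open (O i k)) ->
  [set x : K -> B | x a <> b0] `<=` \bigcup_i box (S i) (O i) ->
  exists2 Y, countable Y &
    [set x : K -> B | x a <> b0] `<=` \bigcup_(i in Y) box (S i) (O i).
Proof.
move=> cB lB fS oO cov.
pose good (A : set (set_type (~` [set b0]))) (D : set I) :=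
  finite_set D /\ [set x : K -> B | exists2 b, A b & val b = x a] `<=`
    \bigcup_(i in D) box (S i) (O i).
have [|V [VU cV Vcov]] := lB [set A | open A /\ exists D, good A D].
  split=> [A []//|]; apply/seteqP; split => // b _.
  have nb : val b <> b0 by have /set_mem := valP b.
  have [|V [D [[oV Vb] fD VD]]] := tube_boxes S O a (val b) cB fS oO.
    by move=> x xa; apply: cov => /=; rewrite xa.
  exists (val @^-1` V) => //; split; first by exists V.
  exists D; split => // x [d Vd dx]; apply: VD.
  by rewrite /= -dx.
have /choice[E EP] : forall A, exists D, V A -> good A D.
  move=> A; have [VA|nVA] := pselect (V A); last by exists set0.
  by have [_ [D gD]] := VU A VA; exists D.
exists (\bigcup_(A in V) E A).
  apply: bigcup_countable => // A VA; apply: finite_set_countable.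
  by have [] := EP A VA.
move=> x xa.
have xa' : x a \in ~` [set b0] by exact: mem_set.
have : [set: set_type (~` [set b0])] (exist _ (x a) xa') by [].
rewrite -Vcov => -[A VA Ax].
have [_ /(_ x)[]] := EP A VA; first by exists (exist _ (x a) xa').
by move=> i Ei xi; exists i => //; exists A.
Qed.

(* [set_type A] is the subspace A; [{ptws K -> B}] is the product B^K. *)
Theorem theorem1 (B : topologicalType) (b0 : B) :
  cover_compact [set: B] ->
  lindelof_space (set_type (~` [set b0])) ->
  forall K : Type,
    star_lindelof_space
      (set_type (~` [set (fun _ : K => b0) : {ptws K -> B}])).
Proof.
move=> cB lB K U [oU covU].
set X := set_type _ in U oU covU *.
(* To each [x] is attached a box around it whose trace on [X] lies in one member of the cover. *)
have /choice[SO SOP] (x : X) : exists SO : set K * (K -> set B),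
    [/\ finite_set SO.1, forall k, open_nbhs (val x k) (SO.2 k) &
       exists2 A, U A & forall y : X, box SO.1 SO.2 (val y) -> A y].
  have : [set: X] x by [].
  rewrite -covU => -[A UA Ax].
  have [W oW WA] := oU A UA.
  have /nbhs_box[SO [fS oO sW]] : nbhs (val x) W.
    by apply: open_nbhs_nbhs; split => //; rewrite -WA in Ax.
  exists SO; split => //; exists A => // y /sW.
  by rewrite -WA.
pose S x := (SO x).1; pose O x := (SO x).2; pose N x := box (S x) (O x).
have fS x : finite_set (S x) by have [] := SOP x.
have oO x k : open (O x k) by have [_ /(_ k)[]] := SOP x.
have toX (x : K -> B) : x <> (fun=> b0) -> exists y : X, val y = x.
  move=> x0; have xX : x \in ~` [set (fun=> b0) : {ptws K -> B}].
    exact: mem_set.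
  by exists (exist _ x xX).
have /choice[Y YP] a : exists Y, countable Y /\
    [set x : K -> B | x a <> b0] `<=` \bigcup_(i in Y) N i.
  have [|Y cY covY] := lindelof_slab b0 S O a cB lB fS oO; last by exists Y.
  move=> x xa; have [|y <-] := toX x; first by move=> x0; apply: xa; rewrite x0.
  by exists y => // k _; have [_ /(_ k)[]] := SOP y.
have Ndep x p q : (forall k, S x k -> p k = q k) -> N x p -> N x q.
  by move=> pq xp k Sk; rewrite -pq//; exact: xp.
have [||F [cF F0 hit]] := countable_hitting b0 S N Y fS Ndep.
- by move=> a; have [] := YP a.
- by move=> a x xa; have [_ /(_ x xa)[y]] := YP a; exists y.
exists [set z : X | F (val z)]; split.
  have /countable_injP[g ginj] := cF.
  apply/countable_injP; exists (g \o val) => y z /set_mem Fy /set_mem Fz gyz.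
  by apply: val_inj; apply: ginj => //; exact: mem_set.
apply/seteqP; split => // z _.
(* [z] and a point of [F] share the box of some [x], hence the member of [U] containing its
   trace. *)
have [|x [xz [f [xf Ff]]]] := hit (val z); first by have /set_mem := valP z.
have [y yf] := toX f (F0 f Ff).
have [_ _ [A UA xA]] := SOP x.
exists A; last exact: xA.
by split => //; exists y; split; [apply: xA|]; rewrite /= yf.
Qed.
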